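(* Let $A_{n^+,n^-}$ be the commutative algebra with basis $\{C_\mu\}$ indexed by triples $\mu=(\kappa^+,\kappa^-,\lambda)$ with $n^\pm(\mu)=n^\pm$, and identify $A_{n^+,n^-}$ with the space of polynomials in $p_k^+,p_k^-,q_k$ that are bihomogeneous of bidegree $(n^+,n^-)$ via the linear isomorphism $p_\mu\leftrightarrow C_\mu/|C_\mu|$. Let $C_2\in A_{n^+,n^-}$ be the sum of all transpositions. Then under this identification, left multiplication by $C_2$ on $A_{n^+,n^-}$ coincides with the differential operator $W^+$ at $\hbar=1$: $$W^+\big|_{\hbar=1}=\sum_{i,j\ge1}\Big(p_i^{\bar i}p_j^{+}\frac{\partial}{\partial p_{i+j}^{\bar i}}+p_{i+j}^{\bar i}\frac{\partial^2}{\partial p_i^{\bar i}\partial p_j^{+}}\Big)+\sum_{i\ge1}\Big(i\,p_{2i}^{+}\frac{\partial}{\partial q_i}+q_i\frac{\partial}{\partial p_{2i}^{+}}\Big),$$ where $\bar i$ is $+$ for $i$ even and $-$ for $i$ odd.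
   Context: For a finite set $N=N^+\sqcup N^-$ with $|N^\pm|=n^\pm$: a state is a partition of $N$ into singletons and two-element subsets each containing one element of $N^+$ and one of $N^-$; a transition is an ordered pair $(s,s')$ of states (initial, final); composition $(s_1,s_1')(s_2,s_2')=(s_1,s_2')$ if $s_1'=s_2$ and $0$ otherwise. A transposition is a transition whose states differ only in two elements which form a pair in one state and are singletons in the other. $T_{n^+,n^-}$ is the $\mathbb{Q}$-algebra spanned by transitions with this product; $A_{n^+,n^-}$ is its $S(N^+)\times S(N^-)$-invariant subalgebra, with basis $C_\mu$ = sum of all transitions of type $\mu$, and $|C_\mu|$ is the number of transitions of type $\mu$. Type of $(s,s')$: in the graph on $N$ with edges the pairs of $s$ and $s'$, components are cycles (length $2\ell$) or paths; a path with an odd number of elements has the sign ($+$ for $N^+$, $-$ for $N^-$) of its endpoints; a path with an even number of elements is $+$ if both endpoints are singletons of $s$ and $-$ if both are singletons of $s'$; the type is $(\kappa^+,\kappa^-,\lambda)$ with $\kappa^\pm$ the numbers of elements of $\pm$ paths and $\lambda$ the half-lengths of cycles. $n^\pm(\mu)$ are given by $n^+=\sum_{k\in\kappa^+}\lceil k/2\rceil+\sum_{k\in\kappa^-}\lfloor k/2\rfloor+\sum_{\ell\in\lambda}\ell$, $n^-=\sum_{k\in\kappa^+}\lfloor k/2\rfloor+\sum_{k\in\kappa^-}\lceil k/2\rceil+\sum_{\ell\in\lambda}\ell$. Bidegrees: $\mathrm{bdeg}\,p_{2k}^\pm=\mathrm{bdeg}\,q_k=(k,k)$, $\mathrm{bdeg}\,p_{2k+1}^+=(k+1,k)$,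 $\mathrm{bdeg}\,p_{2k+1}^-=(k,k+1)$; $p_\mu=\prod p_{k_i^+}^+\prod p_{k_i^-}^-\prod q_{\ell_i}$ has bidegree $(n^+(\mu),n^-(\mu))$. *)

(* Defs.v *)
From HB Require Import structures.
From mathcomp Require Import all_boot all_order all_algebra.
Set Implicit Arguments. Unset Strict Implicit. Unset Printing Implicit Defensive.
Import Order.TTheory GRing.Theory Num.Theory.
Local Open Scope ring_scope.

(* N^+ = 'I_np, N^- = 'I_nm; an element of N is a vertex. *)
Definition vtx (np nm : nat) := ('I_np + 'I_nm)%type.

(* A state: a partition of N into singletons and pairs {a,b} with a in N^+,
   b in N^-; encoded as the partial injection N^+ -> N^- sending a to its
   partner (None if a is a singleton). *)
Definition matching np nm (f : {ffun 'I_np -> option 'I_nm}) : bool :=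
  [forall a, forall a', (f a != None) ==> (f a == f a') ==> (a == a')].

Definition state (np nm : nat) := {f : {ffun 'I_np -> option 'I_nm} | matching f}.

Definition trans (np nm : nat) := (state np nm * state np nm)%type.

Definition partner np nm (s : state np nm) (v : vtx np nm) : option (vtx np nm) :=
  match v with
  | inl a => omap inr (val s a)
  | inr b => omap inl [pick a | val s a == Some b]
  end.

Definition adj np nm (s s' : state np nm) : rel (vtx np nm) :=
  fun u v => (partner s u == Some v) || (partner s' u == Some v).

(* (Some true, k) = p_k^+, (Some false, k) = p_k^-, (None, l) = q_l.
   A monomial p_mu = prod p^+_{k} prod p^-_{k} prod q_l is the multiset of its
   variables (a seq, compared up to permutation); it is the same datum as the
   triple mu = (kappa^+, kappa^-, lambda). *)
Definition var := (option bool * nat)%type.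
Definition pv (b : bool) (k : nat) : var := (Some b, k).
Definition qv (l : nat) : var := (None, l).

(* The component (path or cycle) of the root vertex v, as a variable:
   a cycle of 2l elements gives q_l; a path with k elements gives p_k^{sign}. *)
Definition desc np nm (s s' : state np nm) (v : vtx np nm) : var :=
  let C := [set u | connect (adj s s') v u] in
  let k := #|C| in
  match [pick u in C | (partner s u == None) || (partner s' u == None)] with
  | None => qv k./2                                   (* cycle, 2l elements *)
  | Some u =>                                         (* u is an endpoint *)
      if odd k then pv (if u is inl _ then true else false) k
      else pv (partner s u == None) k
  end.

Definition typ np nm (t : trans np nm) : seq var :=
  [seq desc t.1 t.2 v | v <- enum (roots (adj t.1 t.2))].

Definition nplus_var (x : var) : nat :=
  match x with
  | (Some true, k) => uphalf k | (Some false, k) => k./2 | (None, l) => l end.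
Definition nminus_var (x : var) : nat :=
  match x with
  | (Some true, k) => k./2 | (Some false, k) => uphalf k | (None, l) => l end.
Definition nplus (mu : seq var) : nat := sumn (map nplus_var mu).
Definition nminus (mu : seq var) : nat := sumn (map nminus_var mu).

(* Elements: rational linear combinations of transitions = functions trans -> rat.
   Product extending (s1,s1')(s2,s2') = [s1' = s2] (s1,s2'). *)
Definition telt np nm := {ffun trans np nm -> rat}.

Definition mulT np nm (x y : telt np nm) : telt np nm :=
  [ffun t : trans np nm => \sum_(s : state np nm) x (t.1, s) * y (s, t.2)].

Definition Cmu np nm (mu : seq var) : telt np nm :=
  [ffun t : trans np nm => (perm_eq (typ t) mu)%:R].
Definition cardC np nm (mu : seq var) : nat :=
  #|[pred t : trans np nm | perm_eq (typ t) mu]|.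

Definition transposition np nm (t : trans np nm) : bool :=
  [exists a, exists b,
     (((val t.1 a == Some b) && (val t.2 a == None))
      || ((val t.1 a == None) && (val t.2 a == Some b)))
     && [forall a', (a' != a) ==> (val t.1 a' == val t.2 a')]].
Definition C2 np nm : telt np nm := [ffun t => (transposition t)%:R].

Definition fpoly := seq (rat * seq var).

Definition Phi np nm (P : fpoly) : telt np nm :=
  [ffun t : trans np nm =>
     \sum_(x <- P) x.1 * (Cmu np nm x.2 t / (cardC np nm x.2)%:R)].

Definition bar (i : nat) : bool := ~~ odd i.

(* W^+ at hbar = 1 applied to the monomial m.  Derivatives are computed on
   monomials: d/dv (v^c r) = c v^(c-1) r.  The sums over i, j >= 1 are
   truncated at B = 1 + (sum of indices in m); all omitted terms vanish. *)
Definition Wplus (m : seq var) : fpoly :=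
  let B := (sumn (map snd m)).+1 in
  let I := iota 1 B in
  flatten [seq flatten [seq
     [:: ((count_mem (pv (bar i) (i + j)) m)%:R,
          pv (bar i) i :: pv true j :: rem (pv (bar i) (i + j)) m);
         ((count_mem (pv true j) m * count_mem (pv (bar i) i) (rem (pv true j) m))%:R,
          pv (bar i) (i + j) :: rem (pv (bar i) i) (rem (pv true j) m))]
     | j <- I] | i <- I]
  ++ flatten [seq
     [:: ((i * count_mem (qv i) m)%:R, pv true (i.*2) :: rem (qv i) m);
         ((count_mem (pv true (i.*2)) m)%:R, qv i :: rem (pv true (i.*2)) m)]
     | i <- I].

(* Main.v *)
Require Import Defs.
From HB Require Import structures.
From mathcomp Require Import all_boot all_order all_algebra.
From mathcomp Require Import zify.
Set Implicit Arguments. Unset Strict Implicit. Unset Printing Implicit Defensive.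
Import Order.TTheory GRing.Theory Num.Theory.
Local Open Scope ring_scope.

(** Orient the pairs of the initial state from N^+ to N^- and those of the final
    state from N^- to N^+.  A transition then becomes a partial injection of N,
    whose chains and cycles are the components of the graph, and the sign of a
    path is the sign of its last element.  Composing with a transposition adds
    or removes one arrow issued from an element of N^+: removing one cuts a path
    or opens a cycle, adding one concatenates two paths or closes a path.
    Listing these moves shows that the number of transpositions leading from a
    given transition of type nu to type mu is the coefficient of p_mu in
    W^+ p_nu.  Since transpositions are symmetric, counting pairs of transitions
    in two ways gives |C_nu| [p_mu] W^+ p_nu = |C_mu| [p_nu] W^+ p_mu, which is
    the theorem, both sides being evaluated at a transition of type nu.  If C_mu
    is empty, both coefficients vanish, because the first one does and each term
    of W^+ is reversed by another one. *)

(** * Chains of a partial function *)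

Section Chains.
Variable T : finType.
Implicit Types (f : T -> option T) (o : option T) (D : seq (bool * seq T)).

Definition nxt (c : seq T) o := if c is y :: _ then Some y else o.

(** The argument [o] is the value required of [f] at the last element: [None] for a path, the head
    of the list for a cycle. *)
Fixpoint linked f (c : seq T) o : bool :=
  if c is x :: c' then (f x == nxt c' o) && linked f c' o else true.

Definition upd f x o : T -> option T := fun v => if v == x then o else f v.

Definition noim f y := [forall x, f x != Some y].

(* The boolean tells whether the listed elements form a cycle or a path. *)
Definition wf_chain f (c : bool * seq T) :=
  (c.2 != [::]) && linked f c.2 (if c.1 then nxt c.2 None else None).

Definition decomp f D :=
  [/\ uniq (flatten (map snd D)), forall v, v \in flatten (map snd D)
    & all (wf_chain f) D].

Lemma linked_cat f c1 c2 o :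
  linked f (c1 ++ c2) o = linked f c1 (nxt c2 o) && linked f c2 o.
Proof.
elim: c1 => //= x c1 ->; rewrite andbA; congr (_ && _ && _).
by case: c1.
Qed.

Lemma linked_rcons f c x o :
  linked f (rcons c x) o = linked f c (Some x) && (f x == o).
Proof. by rewrite -cats1 linked_cat /= andbT. Qed.

Lemma eq_linked f g c o : {in c, f =1 g} -> linked f c o = linked g c o.
Proof.
elim: c => //= x c IH fg; rewrite fg ?mem_head // IH // => y yc.
by apply: fg; rewrite inE yc orbT.
Qed.

Lemma linked_upd f x o c p : x \notin c -> linked (upd f x o) c p = linked f c p.
Proof.
move=> xc; apply: eq_linked => y yc; rewrite /upd.
by case: eqP => // yx; rewrite -yx yc in xc.
Qed.

Lemma updE f x o : upd f x o x = o.
Proof. by rewrite /upd eqxx. Qed.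

(** Each element but the last is sent to its neighbour, which yields the tail, and the last one is
    sent to [o]. A path or a cycle is therefore closed under [f]. *)
Lemma linked_imP f c o y : linked f c o -> c != [::] ->
  reflect (exists2 x, x \in c & f x = Some y) ((y \in behead c) || (o == Some y)).
Proof.
elim: c => //= x c IH /andP[/eqP fx lc] _.
case: c IH fx lc => [|z c] IH fx lc.
  rewrite /= in fx; rewrite in_nil /=; apply: (iffP eqP) => [oy|[v]].
    by exists x; rewrite ?mem_head // fx.
  by rewrite inE => /eqP-> <-; rewrite fx.
rewrite inE -orbA; apply: (iffP orP) => [[/eqP->|h]|[v]].
- by exists x; rewrite ?mem_head.
- by have [v vc fv] := elimT (IH lc isT) h; exists v => //; rewrite inE vc orbT.
- rewrite inE => /orP[/eqP-> | vc fv].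
    by rewrite fx => -[->]; left.
  by right; apply/(IH lc isT); exists v.
Qed.

Lemma linked_last_some f c x : linked f c (Some x) -> all (fun v => f v != None) c.
Proof.
elim: c => //= v c IH /andP[/eqP-> /IH->]; rewrite andbT.
by case: c {IH}.
Qed.

Lemma eq_decomp f g D : f =1 g -> decomp f D -> decomp g D.
Proof.
move=> fg [u cov wf]; split=> //; rewrite -(eq_all (a1 := wf_chain f)) // => c.
by rewrite /wf_chain (@eq_linked f g).
Qed.

Lemma perm_decomp f D D' : perm_eq D D' -> decomp f D -> decomp f D'.
Proof.
move=> p [u cov wf].
have pf : perm_eq (flatten (map snd D)) (flatten (map snd D')).
  by apply/perm_flatten/perm_map.
by split=> [|v|]; rewrite -?(perm_uniq pf) -?(perm_mem pf) -?(perm_all _ p).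
Qed.

Lemma decomp_rem f D c : decomp f D -> c \in D -> decomp f (c :: rem c D).
Proof. by move=> dD cD; apply: perm_decomp dD; apply: perm_to_rem. Qed.

Lemma decomp_chain f D c : decomp f D -> c \in D -> wf_chain f c.
Proof. by case=> _ _ /allP wf /wf. Qed.

Lemma decomp_chain_uniq f D c : decomp f D -> c \in D -> uniq c.2.
Proof.
move=> dD cD; have [] := decomp_rem dD cD.
by rewrite /= cat_uniq => /andP[].
Qed.

Lemma decomp_chain_eq f D c c' x : decomp f D -> c \in D -> c' \in D ->
  x \in c.2 -> x \in c'.2 -> c = c'.
Proof.
move=> dD cD c'D xc xc'; have [u _ _] := decomp_rem dD cD.
move: c'D; rewrite (perm_mem (perm_to_rem cD)) inE => /orP[/eqP->//|c'D].
move: u; rewrite /= cat_uniq => /and3P[_ /hasPn h _].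
suff /h : x \in flatten (map snd (rem c D)) by rewrite /= xc.
by apply/flattenP; exists c'.2 => //; apply: map_f.
Qed.

Lemma decomp_uniq f D : decomp f D -> uniq D.
Proof.
case=> + _; elim: D => //= c D IH; rewrite cat_uniq => /and3P[_ /hasPn h u].
case/andP=> /andP[cn _] wf; rewrite IH // andbT; apply/negP => cD.
case E: c.2 cn => [|x s] // _.
have /h : x \in flatten (map snd D).
  by apply/flattenP; exists c.2; [exact: map_f | rewrite E mem_head].
by rewrite /= E mem_head.
Qed.

Lemma decomp_cover f D x : decomp f D -> exists2 c, c \in D & x \in c.2.
Proof.
by case=> _ /(_ x) /flattenP[s /mapP[c cD ->] xc] _; exists c.
Qed.

(** An antecedent of [y] lies in some chain, which also contains its image [y] and so is [c] itself.
    Within [c], only the head of a path is reached by no link. *)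
Lemma decomp_noim f D c y : decomp f D -> c \in D -> y \in c.2 ->
  noim f y = ~~ c.1 && (Some y == ohead c.2).
Proof.
move=> dD cD yc.
have /andP[cn lc] := decomp_chain dD cD.
have uc := decomp_chain_uniq dD cD.
have -> : noim f y = ~~ ((y \in behead c.2)
            || ((if c.1 then nxt c.2 None else None) == Some y)).
  apply/forallP/idP => [h|/negP h x].
    apply/negP => /(linked_imP y lc cn)[x _ fx].
    by have := h x; rewrite fx eqxx.
  apply/negP => /eqP fx; apply: h.
  apply/(linked_imP y lc cn); exists x => //.
  have [c' c'D xc'] := decomp_cover x dD.
  have /andP[c'n lc'] := decomp_chain dD c'D.
  suff yc' : y \in c'.2 by rewrite (decomp_chain_eq dD cD c'D yc yc').
  have : exists2 z, z \in c'.2 & f z = Some y by exists x.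
  case/(linked_imP y lc' c'n)/orP; first exact: mem_behead.
  by case: (c'.1) => //; case: (c'.2) => //= z s /eqP[<-]; rewrite mem_head.
case: c.2 yc uc {lc cn cD} => //= z s; rewrite inE => + /andP[zs _].
case: c.1 => /=; rewrite ?orbF.
  by rewrite (inj_eq Some_inj) (eq_sym z) orbC => ->.
rewrite (inj_eq Some_inj) => /orP[/eqP->|ys]; first by rewrite eqxx zs.
by rewrite ys; case: eqP => // yz; rewrite -yz ys in zs.
Qed.

Lemma decomp_none f D c x : decomp f D -> c \in D -> x \in c.2 ->
  (f x == None) = ~~ c.1 && (Some x == ohead (rev c.2)).
Proof.
move=> dD cD; have uc := decomp_chain_uniq dD cD.
have /andP[] := decomp_chain dD cD.
case/lastP: c.2 uc => // s z; rewrite rcons_uniq rev_rcons => /andP[zs us] _.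
rewrite linked_rcons mem_rcons inE /= (inj_eq Some_inj).
case/andP=> /linked_last_some/allP hs /eqP fz /orP[/eqP->|xs].
  by rewrite eqxx fz; case: c.1 => //=; case: (s) => [|? ?].
rewrite (negPf (hs _ xs)); case: eqP => [xz|_]; last by rewrite andbF.
by rewrite -xz xs in zs.
Qed.

Lemma decomp_none_last f D x : decomp f D -> f x = None ->
  exists s, (false, rcons s x) \in D.
Proof.
move=> dD fx; have [c cD xc] := decomp_cover x dD.
have := decomp_none dD cD xc; rewrite fx eqxx => /esym/andP[].
case: c cD xc => -[] //= c cD xc _.
case/lastP: c cD xc => // s z cD _; rewrite rev_rcons /= => /eqP[->].
by exists s.
Qed.

Lemma decomp_noim_head f D y : decomp f D -> noim f y ->
  exists s, (false, y :: s) \in D.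
Proof.
move=> dD ny; have [c cD yc] := decomp_cover y dD.
have := decomp_noim dD cD yc; rewrite ny => /esym/andP[].
by case: c cD yc => -[] //= [|z s] //= cD _ _ /eqP[->]; exists s.
Qed.

(** * Effect on the chains of changing one arrow *)

Lemma wf_chain_upd f x o D : x \notin flatten (map snd D) ->
  all (wf_chain f) D -> all (wf_chain (upd f x o)) D.
Proof.
move=> xD /allP wf; apply/allP => c cD; have := wf _ cD; rewrite /wf_chain.
rewrite linked_upd //; apply: contra xD => xc.
by apply/flattenP; exists c.2 => //; apply: map_f.
Qed.

(** Only the image of [x] changes, and by uniqueness [x] occurs nowhere else, so all other links
    survive. The same argument serves for closing and for cutting. *)
Lemma decomp_join f D s x y w :
  decomp f ((false, rcons s x) :: (false, y :: w) :: D) ->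
  decomp (upd f x (Some y)) ((false, rcons s x ++ y :: w) :: D).
Proof.
case=> u cov /=; rewrite {1 2}/wf_chain /= linked_rcons.
case/and3P=> /andP[_] /andP[l1 _] l2 wf.
split=> [|v|] /=; [by rewrite -catA | by have := cov v; rewrite /= -catA |].
move: u; rewrite /= -cats1 -catA cat_uniq => /and3P[_ h].
rewrite /= inE mem_cat !negb_or => /andP[] /and3P[xy xw xD] _.
have xs : x \notin s by apply: contra h => xs; rewrite /= xs.
rewrite wf_chain_upd // andbT /wf_chain /= -catA linked_cat /= linked_upd // l1.
rewrite updE eqxx /= -/(linked (upd f x (Some y)) (y :: w) None).
by rewrite linked_upd ?inE ?negb_or ?xy // [linked f _ _]l2 andbT; case: (s).
Qed.

Lemma decomp_close f D s y x : ohead (rcons s x) = Some y ->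
  decomp f ((false, rcons s x) :: D) ->
  decomp (upd f x (Some y)) ((true, rcons s x) :: D).
Proof.
move=> hy [u cov /=]; rewrite /wf_chain /= => /andP[/andP[n l] wf].
split=> //=; move: u; rewrite /= cat_uniq rcons_uniq => /and3P[/andP[xs us] h uD].
have xD : x \notin flatten (map snd D).
  by apply: contra h => xD; apply/hasP; exists x; rewrite // mem_rcons mem_head.
rewrite wf_chain_upd // andbT /wf_chain /= n linked_rcons linked_upd // updE.
move: l; rewrite linked_rcons => /andP[-> _] /=.
by move: hy; case: (s) => [|? ?] /= <-.
Qed.

Lemma decomp_cut_path f D s x y w :
  decomp f ((false, rcons s x ++ y :: w) :: D) ->
  decomp (upd f x None) ((false, rcons s x) :: (false, y :: w) :: D).
Proof.
case=> u cov /=; rewrite {1}/wf_chain /=.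
case/andP=> /andP[_]; rewrite linked_cat linked_rcons => /andP[/andP[l1 _] l2] wf.
split=> [|v|] /=; [by move: u; rewrite /= -catA | by have := cov v; rewrite /= -catA |].
move: u; rewrite /= -cats1 -!catA cat_uniq => /and3P[_ h].
rewrite /= inE mem_cat !negb_or => /andP[] /and3P[xy xw xD] _.
have xs : x \notin s by apply: contra h => xs; rewrite /= xs.
rewrite wf_chain_upd // andbT /wf_chain /= linked_cat /= linked_upd // l1.
rewrite updE eqxx /= -/(linked (upd f x None) (y :: w) None).
by rewrite linked_upd ?inE ?negb_or ?xy // [linked f _ _]l2 andbT; case: (s).
Qed.

(** The opened cycle is listed from the successor of [x] round to [x], which has become the last
    element of a path. *)
Lemma decomp_cut_cycle f D s x w :
  decomp f ((true, rcons s x ++ w) :: D) ->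
  decomp (upd f x None) ((false, w ++ rcons s x) :: D).
Proof.
case=> u cov /=; rewrite {1}/wf_chain /=.
case/andP=> /andP[_]; rewrite linked_cat linked_rcons => /andP[/andP[l1 _] l2] wf.
have pp : perm_eq ((rcons s x ++ w) ++ flatten (map snd D))
                  (flatten (map snd ((false, w ++ rcons s x) :: D))).
  by rewrite /= perm_cat2r perm_catC.
split=> [|v|]; [by rewrite -(perm_uniq pp)|by rewrite -(perm_mem pp)|].
move: u; rewrite /= -cats1 -!catA cat_uniq => /and3P[_ h].
rewrite /= mem_cat !negb_or => /andP[] /andP[xw xD] _.
have xs : x \notin s by apply: contra h => xs; rewrite /= xs.
rewrite wf_chain_upd // andbT /wf_chain /=.
rewrite linked_cat cats1 linked_rcons !linked_upd // l1 updE eqxx /= andbT.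
have -> : nxt (rcons s x) None = nxt (rcons s x ++ w) None by case: (s).
by rewrite l2 andbT; case: (w); case: (s).
Qed.

(** [x] ends a path and [y] starts one: the new arrow closes the path if the two coincide and joins
    them otherwise. *)
Lemma decomp_add f D x y : decomp f D -> f x = None -> noim f y ->
  exists D', decomp (upd f x (Some y)) D'.
Proof.
move=> dD fx ny.
have [s sD] := decomp_none_last dD fx.
have [w wD] := decomp_noim_head dD ny.
have d1 := decomp_rem dD sD.
move: (wD); rewrite (perm_mem (perm_to_rem sD)) inE => /orP[/eqP[E]|wD'].
  exists ((true, rcons s x) :: rem (false, rcons s x) D).
  by apply: decomp_close d1; rewrite -E.
exists ((false, rcons s x ++ y :: w) :: rem (false, y :: w) (rem (false, rcons s x) D)).
apply: decomp_join; apply: perm_decomp d1.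
by rewrite perm_cons perm_to_rem.
Qed.

(** Induction on the number of arrows: without arrows every element is a path of its own, and a
    removed arrow is put back by [decomp_add]. *)
Lemma decomp_exists f : (forall x y z, f x = Some z -> f y = Some z -> x = y) ->
  exists D, decomp f D.
Proof.
move: {2}#|_| (erefl #|[pred x | f x != None]|) => n.
elim: n f => [|n IH] f cn inj.
  exists [seq (false, [:: x]) | x <- enum T].
  have E : flatten (map snd [seq (false, [:: x]) | x <- enum T]) = enum T.
    by rewrite -map_comp; elim: (enum T) => //= x s ->.
  split; rewrite ?E ?enum_uniq //; first by move=> v; rewrite mem_enum.
  apply/allP => c /mapP[x _ ->]; rewrite /wf_chain /= andbT.
  by have := card0_eq cn x; rewrite !inE => /negbFE.
have /card_gt0P[x] : (0 < #|[pred x | f x != None]|)%N by rewrite cn.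
rewrite !inE; case fx: (f x) => [y|] // _.
have [||D dD] := IH (upd f x None).
- move: cn; rewrite (cardD1 x) inE fx add1n => -[<-]; apply: eq_card => v.
  by rewrite !inE /upd; case: (v == x).
- move=> a b z; rewrite /upd; case: eqP => // _ fa; case: eqP => // _.
  exact: inj fa.
have [|| D' dD'] := decomp_add (x := x) (y := y) dD; first by rewrite updE.
  (* Once the arrow from [x] is removed, injectivity leaves [y] without antecedent. *)
  apply/forallP => z; rewrite /upd; case: (z =P x) => // zx; apply/negP => /eqP fz.
  by apply: zx; apply: inj fz fx.
exists D'; apply: eq_decomp dD' => v; rewrite /upd.
by case: eqP => // ->; rewrite fx.
Qed.

End Chains.

(** * The operator W^+ *)

Lemma perm_rem (T : eqType) (x : T) s1 s2 :
  perm_eq s1 s2 -> perm_eq (rem x s1) (rem x s2).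
Proof.
by move=> p; apply/permP => a; rewrite !count_rem (perm_mem p) (permP p).
Qed.

Lemma perm_rem_cons (T : eqType) (x : T) s1 s2 :
  perm_eq s1 (x :: s2) -> perm_eq (rem x s1) s2.
Proof. by move/(perm_rem x); rewrite /= eqxx. Qed.

Lemma perm_swap (T : eqType) (x y : T) s : perm_eq (x :: y :: s) (y :: x :: s).
Proof. by rewrite -(cat1s x) -(cat1s y s) perm_catCA. Qed.

(** Turns an exponent, the coefficient produced by a derivative, into a sum over the occurrences of
    the variable. *)
Lemma natr_count_mul (T : eqType) (a : T) m (e : T -> rat) :
  (count_mem a m)%:R * e a = \sum_(v <- m) (if v == a then e v else 0).
Proof.
rewrite -big_mkcond /=; elim: m => [|v m IH]; first by rewrite big_nil mul0r.
rewrite big_cons /= -IH natrD mulrDl.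
by case: eqP => [->|]; rewrite ?mul1r // mul0r add0r.
Qed.

Lemma sum_iota_delta B a (E : nat -> rat) :
  \sum_(i <- iota 1 B) (if i == a then E i else 0) =
  if (0 < a <= B)%N then E a else 0.
Proof.
rewrite -big_mkcond /=; case: ifP => h.
  rewrite -big_filter (filter_pred1_uniq (iota_uniq _ _)) ?big_seq1 //.
  by rewrite mem_iota; lia.
rewrite big_seq_cond big1 // => i /andP[]; rewrite mem_iota => ib /eqP ia.
by lia.
Qed.

(** The linear extension of [F] evaluated at W^+ p_m. When [F] is the indicator of a monomial, this
    is the coefficient of that monomial. *)
Definition Wsum (m : seq var) (F : seq var -> rat) : rat :=
  \sum_(x <- Wplus m) x.1 * F x.2.

Lemma WsumE m F : let I := iota 1 (sumn (map snd m)).+1 in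
    Wsum m F =
  \sum_(i <- I) \sum_(j <- I)
    ((count_mem (pv (bar i) (i + j)) m)%:R *
       F (pv (bar i) i :: pv true j :: rem (pv (bar i) (i + j)) m) +
     (count_mem (pv true j) m *
       count_mem (pv (bar i) i) (rem (pv true j) m))%:R *
       F (pv (bar i) (i + j) :: rem (pv (bar i) i) (rem (pv true j) m))) +
  \sum_(i <- I)
    ((i * count_mem (qv i) m)%:R * F (pv true i.*2 :: rem (qv i) m) +
     (count_mem (pv true i.*2) m)%:R * F (qv i :: rem (pv true i.*2) m)).
Proof.
rewrite /Wsum /Wplus; cbv zeta; move: (iota _ _) => I.
rewrite big_cat /= !big_flatten /= !big_map; congr (_ + _).
  apply: eq_bigr => i _; rewrite big_flatten /= big_map; apply: eq_bigr => j _.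
  by rewrite !big_cons big_nil addr0.
by apply: eq_bigr => i _; rewrite !big_cons big_nil addr0.
Qed.

(** Monomials are lists up to permutation, so these are the functions of monomials. *)
Definition perm_invariant (F : seq var -> rat) :=
  forall m m', perm_eq m m' -> F m = F m'.

Lemma eq_Wsum m m' F : perm_invariant F -> perm_eq m m' -> Wsum m F = Wsum m' F.
Proof.
move=> Fp p; rewrite !WsumE (perm_sumn (perm_map snd p)); congr (_ + _).
  apply: eq_bigr => i _; apply: eq_bigr => j _.
  rewrite !(permP p) (permP (perm_rem _ p)); congr (_ * _ + _ * _); apply: Fp.
    by rewrite !perm_cons perm_rem.
  by rewrite perm_cons !perm_rem.
apply: eq_bigr => i _; rewrite !(permP p).
by congr (_ * _ + _ * _); apply: Fp; rewrite perm_cons perm_rem.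
Qed.

(** * The operator as a sum over the factors of a monomial *)

Section LocalForm.
Variable F : seq var -> rat.

(** Here [r] holds the other factors. A path of [k] elements is cut after its [j]-th one; a cycle
    can be opened at each of its [l] elements of N^+, always with the same result. *)
Definition cut_term (v : var) (r : seq var) : rat :=
  match v with
  | (Some b, k) =>
      \sum_(1 <= j < k | bar (k - j) == b) F (pv b (k - j) :: pv true j :: r)
  | (None, l) => l%:R * F (pv true l.*2 :: r)
  end.

Definition close_term (v : var) (r : seq var) : rat :=
  if v is (Some true, k) then
    if (0 < k)%N && ~~ odd k then F (qv k./2 :: r) else 0
  else 0.

(** The two factors play different roles: [v] is the p_j^+ and [w] the other variable of the second
    derivative. Summing over ordered pairs of occurrences thus gives each choice once. *)
Definition join_term (v w : var) (r : seq var) : rat :=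
  match v, w with
  | (Some true, j), (Some b, i) =>
      if [&& 0 < j, 0 < i & b == bar i]%N then F (pv b (i + j) :: r) else 0
  | _, _ => 0
  end.

Lemma mem_le_sumn (m : seq var) v : v \in m -> (v.2 <= sumn (map snd m))%N.
Proof.
elim: m => //= w m IH; rewrite inE => /orP[/eqP->|/IH]; lia.
Qed.

(** For given [j] only [i = k - j] contributes, and since [k < B] the truncation of the ranges loses
    nothing. *)
Lemma sum_cut_path B (b : bool) k (E : nat -> nat -> rat) : (k < B)%N ->
  \sum_(i <- iota 1 B) \sum_(j <- iota 1 B)
     (if (Some b, k) == pv (bar i) (i + j) then E i j else 0) =
  \sum_(1 <= j < k | bar (k - j) == b) E (k - j)%N j.
Proof.
move=> kB; rewrite exchange_big /=.
rewrite (@big_nat_widen _ _ _ _ _ B.+1); last by lia.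
rewrite /index_iota subSS subn0 [RHS]big_mkcond /= [LHS]big_seq_cond [RHS]big_seq_cond.
apply: eq_bigr => j; rewrite andbT mem_iota => jB.
transitivity (\sum_(i <- iota 1 B) (if i == (k - j)%N then
   (if (bar (k - j) == b) && (j < k)%N then E (k - j)%N j else 0) else 0)).
  rewrite big_seq_cond [RHS]big_seq_cond.
  apply: eq_bigr => i; rewrite andbT mem_iota => iB.
  rewrite /pv xpair_eqE (inj_eq Some_inj) (eq_sym b).
  case: (i =P (k - j)%N) => [ik|ne].
    case: (ltnP j k) => h; last by exfalso; lia.
    by rewrite ik subnK ?eqxx // ltnW.
  by rewrite [k == _](introF eqP) ?andbF //; lia.
rewrite (sum_iota_delta B (k - j)%N
  (fun=> if (bar (k - j) == b) && (j < k)%N then E (k - j)%N j else 0)).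
case: (ltnP j k) => h; rewrite ?andbF /=; last by case: ifP.
by rewrite ifT //; lia.
Qed.

(** The four sums of the operator are treated one by one: coefficients become sums over occurrences,
    the summations are exchanged, and the chosen factor then constrains [i] and [j]. *)
Lemma Wsum_local m :
  Wsum m F = \sum_(v <- m)
    (cut_term v (rem v m) + close_term v (rem v m)
     + \sum_(w <- rem v m) join_term v w (rem w (rem v m))).
Proof.
rewrite WsumE; set B := (sumn _).+1.
under eq_bigr => i _ do rewrite big_split /=.
rewrite !big_split /=.
have swap (E : nat -> nat -> var -> rat) :
    \sum_(i <- iota 1 B) \sum_(j <- iota 1 B) \sum_(v <- m) E i j v =
    \sum_(v <- m) \sum_(i <- iota 1 B) \sum_(j <- iota 1 B) E i j v.
  by under eq_bigr => i _ do rewrite exchange_big; rewrite exchange_big.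
have le_B v : v \in m -> (v.2 < B)%N by move/mem_le_sumn.
have -> : \sum_(i <- iota 1 B) \sum_(j <- iota 1 B)
    (count_mem (pv (bar i) (i + j)) m)%:R *
       F (pv (bar i) i :: pv true j :: rem (pv (bar i) (i + j)) m)
  = \sum_(v <- m) if v is (Some b, k) then cut_term v (rem v m) else 0.
  under eq_bigr => i _ do under eq_bigr => j _ do rewrite
    (natr_count_mul _ _ (fun v => F (pv (bar i) i :: pv true j :: rem v m))).
  rewrite swap big_seq_cond [RHS]big_seq_cond; apply: eq_bigr => v /andP[/le_B].
  case: v => [[b|] k] kB _; last by rewrite big1 // => i _; rewrite big1.
  rewrite (sum_cut_path b (fun i j => F (pv (bar i) i :: pv true j :: rem (Some b, k) m))) //.
  by apply: eq_bigr => j /eqP->.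
have -> : \sum_(i <- iota 1 B) (i * count_mem (qv i) m)%:R * F (pv true i.*2 :: rem (qv i) m)
  = \sum_(v <- m) if v is (None, l) then cut_term v (rem v m) else 0.
  transitivity (\sum_(i <- iota 1 B) \sum_(v <- m) (if v == qv i then
                 i%:R * F (pv true i.*2 :: rem v m) else 0)).
    apply: eq_bigr => i _; rewrite mulnC natrM -mulrA.
    by rewrite (natr_count_mul _ _ (fun v => i%:R * F (pv true i.*2 :: rem v m))).
  rewrite exchange_big /= big_seq_cond [RHS]big_seq_cond; apply: eq_bigr => v /andP[/le_B].
  case: v => [[b|] k] kB _; first by rewrite big1.
  under eq_bigr => i _ do rewrite xpair_eqE eqxx /= eq_sym.
  rewrite (sum_iota_delta B k (fun i => i%:R * F (pv true i.*2 :: rem (None, k) m))) /=.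
  (* The variable q_0 is outside the range of [i], but its cut term carries the factor 0. *)
  case: k kB => [|k] kB; first by rewrite mul0r.
  by rewrite ifT //; apply: ltnW.
have -> : \sum_(i <- iota 1 B) (count_mem (pv true i.*2) m)%:R * F (qv i :: rem (pv true i.*2) m)
  = \sum_(v <- m) close_term v (rem v m).
  under eq_bigr => i _ do rewrite (natr_count_mul _ _ (fun v => F (qv i :: rem v m))).
  rewrite exchange_big /= big_seq_cond [RHS]big_seq_cond; apply: eq_bigr => v /andP[/le_B].
  case: v => [[[]|] k] kB _; [|by rewrite big1..].
  rewrite /= in kB; case: (boolP (odd k)) => ok.
    rewrite big1 /= ?ok ?andbF // => i _; case: eqP => // -[ki].
    by move: ok; rewrite ki odd_double.
  under eq_bigr => i _ do
    rewrite xpair_eqE eqxx /= -[k in k == _](even_halfK ok) (inj_eq double_inj) eq_sym.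
  rewrite (sum_iota_delta B _ (fun i => F (qv i :: rem (Some true, k) m))) /= ok andbT.
  by congr (if _ then _ else _); lia.
have -> : \sum_(i <- iota 1 B) \sum_(j <- iota 1 B)
     (count_mem (pv true j) m *
       count_mem (pv (bar i) i) (rem (pv true j) m))%:R *
       F (pv (bar i) (i + j) :: rem (pv (bar i) i) (rem (pv true j) m))
  = \sum_(v <- m) \sum_(w <- rem v m) join_term v w (rem w (rem v m)).
  (* The occurrence [w] is chosen after [v] has been removed; this gives the right multiplicity even
     when both derivatives are by the same variable. *)
  transitivity (\sum_(i <- iota 1 B) \sum_(j <- iota 1 B) \sum_(v <- m)
     if v == pv true j then \sum_(w <- rem v m) if w == pv (bar i) i then
       F (pv (bar i) (i + j) :: rem w (rem v m)) else 0 else 0).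
    apply: eq_bigr => i _; apply: eq_bigr => j _; rewrite natrM -mulrA.
    rewrite (natr_count_mul _ _ (fun w => F (pv (bar i) (i + j) :: rem w (rem (pv true j) m)))).
    by rewrite (natr_count_mul _ _ (fun v => \sum_(w <- rem v m) if w == pv (bar i) i then
       F (pv (bar i) (i + j) :: rem w (rem v m)) else 0)).
  rewrite swap big_seq_cond [RHS]big_seq_cond; apply: eq_bigr => v /andP[vm _].
  have vB := le_B _ vm; rewrite exchange_big /=.
  case: v vm vB => [[[]|] k] vm kB;
    [|by rewrite big1 => [|i _]; rewrite big1 // => [[[b|] l]]..].
  transitivity (\sum_(j <- iota 1 B) if j == k then \sum_(i <- iota 1 B)
     \sum_(w <- rem (Some true, k) m) (if w == pv (bar i) i then
       F (pv (bar i) (i + j) :: rem w (rem (Some true, k) m)) else 0) else 0).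
    apply: eq_bigr => j _; rewrite /pv xpair_eqE eqxx /= eq_sym.
    by case: eqP => // _; rewrite big1.
  rewrite (sum_iota_delta B k (fun j => \sum_(i <- iota 1 B)
     \sum_(w <- rem (Some true, k) m) (if w == pv (bar i) i then
       F (pv (bar i) (i + j) :: rem w (rem (Some true, k) m)) else 0))).
  rewrite exchange_big /=.
  rewrite /= in kB; case: (posnP k) => [->|k0].
    by rewrite [RHS]big1 // => -[[b|] l].
  rewrite ifT; last by lia.
  rewrite big_seq_cond [RHS]big_seq_cond; apply: eq_bigr => w /andP[/mem_rem/le_B].
  case: w => [[b|] l] /= lB _; last by rewrite big1.
  transitivity (\sum_(i <- iota 1 B) if i == l then if b == bar l then
       F (pv b (l + k) :: rem (Some b, l) (rem (Some true, k) m)) else 0 else 0).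
    apply: eq_bigr => i _; rewrite /pv xpair_eqE (inj_eq Some_inj) andbC eq_sym.
    by case: eqP => //= ->; case: eqP => // ->.
  rewrite (sum_iota_delta B l (fun=> if b == bar l then
       F (pv b (l + k) :: rem (Some b, l) (rem (Some true, k) m)) else 0)).
  case: (posnP l) => //= l0.
  by rewrite ltnW.
rewrite addrACA -!big_split /=; apply: eq_bigr => v _.
rewrite -[RHS]addrA [X in _ = _ + X]addrC; congr (_ + _).
by case: v => [[b|] k]; rewrite ?addr0 ?add0r.
Qed.

End LocalForm.

(** * Reversal of the terms of the operator *)

Lemma sum_neq0_exists (I : eqType) (s : seq I) (P : pred I) (E : I -> rat) :
  \sum_(x <- s | P x) E x != 0 -> exists x, [/\ x \in s, P x & E x != 0].
Proof.
elim: s => [|y s IH]; first by rewrite big_nil eqxx.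
rewrite big_cons; case: ifP => Py; last first.
  by move/IH => [x [xs Px Ex]]; exists x; rewrite inE xs orbT.
have [->|Ey _] := eqVneq (E y) 0; last by exists y; rewrite mem_head.
by rewrite add0r => /IH[x [xs Px Ex]]; exists x; rewrite inE xs orbT.
Qed.

Definition same_monomial (mu x : seq var) : rat := (perm_eq x mu)%:R.

Lemma same_monomial_perm mu : perm_invariant (same_monomial mu).
Proof. by move=> m m' p; rewrite /same_monomial (permPl p). Qed.

Lemma same_monomial_ge0 mu x : 0 <= same_monomial mu x.
Proof. exact: ler0n. Qed.

Lemma same_monomial_neq0 mu x : same_monomial mu x != 0 -> perm_eq x mu.
Proof. by rewrite /same_monomial; case: perm_eq. Qed.

(** The terms of W^+ that cut a path or open a cycle. The joining and closing terms are these steps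
    read backwards. *)
Definition cut_step (m x : seq var) : Prop := exists r,
  (exists i j, [/\ (0 < i)%N, (0 < j)%N, perm_eq m (pv (bar i) (i + j) :: r)
     & perm_eq x (pv (bar i) i :: pv true j :: r)]) \/
  (exists i, [/\ (0 < i)%N, perm_eq m (qv i :: r) & perm_eq x (pv true i.*2 :: r)]).

Lemma cut_term_ge0 F v r : (forall x, 0 <= F x) -> 0 <= cut_term F v r.
Proof.
move=> F0; case: v => [[b|] k] /=; last by rewrite mulr_ge0.
by apply: sumr_ge0.
Qed.

Lemma close_term_ge0 F v r : (forall x, 0 <= F x) -> 0 <= close_term F v r.
Proof. by move=> F0; case: v => [[[]|] k] //=; case: ifP. Qed.

Lemma join_term_ge0 F v w r : (forall x, 0 <= F x) -> 0 <= join_term F v w r.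
Proof.
by move=> F0; case: v => [[[]|] k]; case: w => [[b|] l] //=; case: ifP.
Qed.

Lemma Wsum_cons_ge F v m : (forall x, 0 <= F x) ->
  cut_term F v m + close_term F v m +
  \sum_(w <- m) join_term F v w (rem w m) <= Wsum (v :: m) F.
Proof.
move=> F0; rewrite Wsum_local big_cons /= eqxx lerDl.
apply: sumr_ge0 => w _; rewrite !addr_ge0 ?cut_term_ge0 ?close_term_ge0 //.
by apply: sumr_ge0 => u _; apply: join_term_ge0.
Qed.

(** The step appears as one positive summand in each direction, a cut from [m] to [x] and a join or
    closure from [x] to [m]. All summands are nonnegative, so nothing cancels it. *)
Lemma cut_step_Wsum m x : cut_step m x ->
  (0 < Wsum m (same_monomial x)) /\ (0 < Wsum x (same_monomial m)).
Proof.
have F0 := same_monomial_ge0.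
have J0 y v w r : 0 <= \sum_(u <- w) join_term (same_monomial y) v u (rem u r).
  by apply: sumr_ge0 => u _; apply: join_term_ge0.
case=> r [[i [j [i0 j0 pm px]]] | [i [i0 pm px]]]; split.
- rewrite (eq_Wsum (@same_monomial_perm x) pm).
  apply: lt_le_trans (Wsum_cons_ge _ _ (F0 x)).
  rewrite -addrA ltr_wpDr ?addr_ge0 ?close_term_ge0 ?J0 //=.
  rewrite (big_rem j) /=; last by rewrite mem_index_iota; lia.
  rewrite addnK eqxx ltr_wpDr ?sumr_ge0 //.
  by rewrite /same_monomial perm_sym px ltr01.
(* The first argument of [join_term] has to be the p_j^+, so this factor is moved to the front. *)
- have px' : perm_eq x (pv true j :: pv (bar i) i :: r).
    by rewrite (permPl px) perm_swap.
  rewrite (eq_Wsum (@same_monomial_perm m) px').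
  apply: lt_le_trans (Wsum_cons_ge _ _ (F0 m)).
  rewrite ltr_wpDl ?addr_ge0 ?cut_term_ge0 ?close_term_ge0 //.
  rewrite big_cons ltr_wpDr ?J0 //= i0 j0 !eqxx /=.
  by rewrite /same_monomial perm_sym pm ltr01.
- rewrite (eq_Wsum (@same_monomial_perm x) pm).
  apply: lt_le_trans (Wsum_cons_ge _ _ (F0 x)).
  rewrite -addrA ltr_wpDr ?addr_ge0 ?close_term_ge0 ?J0 //=.
  by rewrite /same_monomial perm_sym px mulr1 ltr0n.
- rewrite (eq_Wsum (@same_monomial_perm m) px).
  apply: lt_le_trans (Wsum_cons_ge _ _ (F0 m)).
  rewrite ltr_wpDr ?J0 // ltr_wpDl ?cut_term_ge0 //=.
  rewrite odd_double double_gt0 i0 /= doubleK.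
  by rewrite /same_monomial perm_sym pm ltr01.
Qed.

(** Some summand is nonzero: a cut term gives a step from [m], a closing or joining term a step from
    [x]. *)
Lemma Wsum_neq0_step m x :
  Wsum m (same_monomial x) != 0 -> cut_step m x \/ cut_step x m.
Proof.
rewrite Wsum_local => /sum_neq0_exists[v [/perm_to_rem vm _]].
move: (rem v m) vm => r vm.
have [->|nz _] := eqVneq (cut_term (same_monomial x) v r) 0; last first.
  left; exists r; case: v vm nz => [[b|] k] vm /=.
    case/sum_neq0_exists => j []; rewrite mem_index_iota => jk /eqP bk.
    move/same_monomial_neq0 => px; left; exists (k - j)%N, j.
    rewrite subnK ?bk; last by lia.
    by split=> //; [lia | lia | rewrite perm_sym].
  rewrite mulf_eq0 negb_or pnatr_eq0 -lt0n => /andP[k0 /same_monomial_neq0 px].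
  by right; exists k; split; rewrite // perm_sym.
rewrite add0r; have [->|nz _] := eqVneq (close_term (same_monomial x) v r) 0; last first.
  right; exists r; right; case: v vm nz => [[[]|] k] vm /=; rewrite ?eqxx //.
  case: ifP => [/andP[k0 ek] /same_monomial_neq0 px|]; last by rewrite eqxx.
  exists k./2; rewrite even_halfK //; split=> //; last by rewrite perm_sym.
  by move: ek k0; case: (k) => [|[]].
rewrite add0r => /sum_neq0_exists[w [/perm_to_rem wr _ nz]].
right; exists (rem w r); left; case: v vm wr nz => [[[]|] k] vm wr; [|by []..].
case: w wr => [[b|] l] wr /=; last by [].
case: ifP => [/and3P[k0 l0 /eqP bl] /same_monomial_neq0 px|]; last by rewrite eqxx.
exists l, k; rewrite -bl; split=> //; first by rewrite perm_sym.
rewrite (permPl vm) (permPr (perm_swap _ _ _)) perm_cons //.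
Qed.

(** Serves when a class is empty: the counting identity then says nothing about the coefficient
    weighted by 0. *)
Lemma Wsum_neq0_sym m x :
  Wsum m (same_monomial x) != 0 -> Wsum x (same_monomial m) != 0.
Proof.
by case/Wsum_neq0_step => /cut_step_Wsum[h1 h2]; rewrite gt_eqF.
Qed.

(** * Moves on a decomposition into chains *)

Section Moves.
Variables (T : finType) (sgn : T -> bool).
Implicit Types (f : T -> option T) (D : seq (bool * seq T)).

Definition alternating f := forall x y, f x = Some y -> sgn y = ~~ sgn x.

(** For the orientation by [succ], a path with an even number of elements ends in N^+ exactly when
    both its ends are singletons of the initial state, so the last element gives the sign in all
    cases. Chains of a decomposition are nonempty, so the default [true] is never reached. *)
Definition chain_var (c : bool * seq T) : var :=
  if c.1 then qv (size c.2)./2 else pv (last true (map sgn c.2)) (size c.2).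

Lemma linked_last_sgn f x w o : alternating f -> linked f (x :: w) o ->
  last (sgn x) (map sgn w) = sgn x (+) odd (size w).
Proof.
move=> alt; elim: w x => [|y w IH] x; first by rewrite addbF.
case/andP=> /eqP /= fx lw; rewrite IH // (alt _ _ fx).
by case: sgn; case: odd.
Qed.

(** The images of the elements of a cycle are these elements again, and [f] changes the sign, so
    half of them have sign [true]. *)
Lemma linked_cycle_size f c : alternating f -> linked f c (nxt c None) ->
  size c = (count sgn c).*2.
Proof.
move=> alt; case: c => //= x w lw.
have E z : linked f (x :: w) (Some z) ->
    count sgn (rcons w z) = count (predC sgn) (x :: w).
  elim: w x {lw} => [|y w IH] x /= /andP[/eqP fx lw].
    by rewrite (alt _ _ fx).
  by rewrite (IH y lw) /= {1}(alt _ _ fx).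
have := E x lw; rewrite -cats1 count_cat /= addn0 addnC => {}E.
by have := count_predC sgn (x :: w); rewrite /= -E -addnn.
Qed.

Lemma sum_decomp f D (E : T -> rat) : decomp f D ->
  \sum_x E x = \sum_(c <- D) \sum_(x <- c.2) E x.
Proof.
case=> u cov _; rewrite -(big_map snd xpredT (fun s => \sum_(x <- s) E x)).
rewrite -big_flatten; apply: perm_big; apply: uniq_perm => //.
  exact: index_enum_uniq.
by move=> x; rewrite mem_index_enum cov.
Qed.

Variables (F : seq var -> rat) (f : T -> option T) (D : seq (bool * seq T)).
Variable Fd : T -> option T -> rat.
Hypothesis F_perm : perm_invariant F.
Hypothesis f_alt : alternating f.
Hypothesis fD : decomp f D.
(** [Fd x o] is the value of [F] after the image of [x] has become [o]. It is prescribed only for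
    changes that keep [f] alternating and injective, with [x] on the side of N^+. *)
Hypothesis FdE : forall x o D', sgn x ->
  (if o is Some y then ~~ sgn y && noim f y else true) ->
  decomp (upd f x o) D' -> Fd x o = F (map chain_var D').

(** A cycle opened after an element of N^+ becomes a path of sign +, and such elements are half of
    the cycle. A path cut after [x] in N^+ has a first part of sign +, while the second part keeps
    the last element and hence the sign of the whole. *)
Lemma sum_cut_chain c : c \in D ->
  \sum_(x <- c.2 | sgn x && (f x != None)) Fd x None =
  cut_term F (chain_var c) (map chain_var (rem c D)).
Proof.
move=> cD; have dD := decomp_rem fD cD; have /andP[cn lc] := decomp_chain fD cD.
move: (rem c D) dD {cD} => r dD.
case: c cn lc dD => [[] c] /= cn lc dD.
  have sz := linked_cycle_size f_alt lc.
  rewrite /chain_var /= sz doubleK -sz.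
  transitivity (\sum_(x <- c | sgn x) F (pv true (size c) :: map chain_var r)).
    rewrite big_seq_cond [RHS]big_seq_cond; apply: eq_big => [x|x].
      case xc: (x \in c) => //=; case: (sgn x) => //=.
      have : f x != None.
        case/splitPr: xc lc => p1 p2; rewrite linked_cat /= => /and3P[_ /eqP-> _].
        by case: p2 => //; case: p1.
      by [].
    case/and3P=> xc sx _; case/splitPr: xc lc dD {sz cn} => p1 p2 lc dD.
    rewrite -cat_rcons in lc dD *.
    rewrite (FdE (o := None) sx isT (decomp_cut_cycle dD)) /= /chain_var /=.
    by rewrite map_cat map_rcons last_cat last_rcons sx !size_cat addnC.
  by rewrite big_const_seq iter_addr_0 mulr_natl.
case: c cn lc dD => // x0 c1 _; move E: (x0 :: c1) => c lc dD.
(* The index becomes the length [j] of the first part, one more than the position of [x]. *)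
rewrite (big_nth x0) -(big_add1 _ _ 0 (size c).+1
  (fun j => sgn (nth x0 c j.-1) && (f (nth x0 c j.-1) != None))
  (fun j => Fd (nth x0 c j.-1) None)).
have sc : (0 < size c)%N by rewrite -E.
(* The last element of a path has no arrow to remove, so its summand vanishes. *)
rewrite big_mkcond big_nat_recr //= [X in _ + X]ifF ?addr0; last first.
  case/lastP: c {E} lc sc {dD} => // s x; rewrite linked_rcons => /andP[_ /eqP fx] _.
  by rewrite size_rcons /= nth_rcons ltnn eqxx fx eqxx andbF.
rewrite [RHS]big_mkcond; apply: eq_big_nat => -[|p] // /andP[_ pc] /=.
have := take_nth x0 (ltnW pc); have := cat_take_drop p.+1 c.
have := size_drop p.+1 c; have := size_takel (ltnW (ltnW pc)).
move: (nth x0 c p) (take p c) (take p.+1 c) (drop p.+1 c) => x s t [|y w] sz szw + E1.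
  by move: szw => /=; lia.
rewrite E1 => Ec; rewrite -Ec in lc dD.
have fx : f x = Some y by move: lc; rewrite linked_cat linked_rcons => /andP[/andP[_ /eqP]].
have sgl : last true (map sgn c) = sgn x (+) odd (size (y :: w)).
  move: lc; rewrite -cats1 -catA linked_cat => /andP[_ /(linked_last_sgn f_alt) <-].
  by rewrite -Ec map_cat last_cat map_rcons last_rcons.
have sgw : last (sgn y) (map sgn w) = sgn x (+) odd (size (y :: w)).
  by rewrite -sgl -Ec map_cat last_cat.
(* By alternation, the parity test in [cut_term] holds exactly when [x] has sign [true]. *)
rewrite fx /= andbT -szw sgl; case sx: (sgn x) => /=; rewrite /bar; last first.
  by rewrite ifF //=; case: (odd (size w)).
rewrite eqxx (FdE (o := None) sx isT (decomp_cut_path dD)) /= /chain_var /=; apply: F_perm.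
by rewrite map_rcons last_rcons size_rcons sz sgw sx perm_swap.
Qed.

Lemma sum_path_end (G : T -> rat) s x : (false, rcons s x) \in D ->
  \sum_(v <- rcons s x | sgn v && (f v == None)) G v = if sgn x then G x else 0.
Proof.
move=> cD; have /andP[_] := decomp_chain fD cD.
rewrite /= linked_rcons => /andP[/linked_last_some/allP ls /eqP fx].
rewrite -cats1 big_cat big_cons big_nil fx eqxx andbT /= addr0.
by rewrite big_seq_cond big1 ?add0r // => v /and3P[/ls/negPf->].
Qed.

Lemma sum_path_start (G : T -> rat) y w : (false, y :: w) \in D ->
  \sum_(v <- y :: w | ~~ sgn v && noim f v) G v = if ~~ sgn y then G y else 0.
Proof.
move=> cD; have /= /andP[yw _] := decomp_chain_uniq fD cD.
rewrite big_cons (decomp_noim fD cD) ?mem_head //= eqxx andbT.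
rewrite big_seq_cond big1 => [|v /and3P[vw _]]; first by rewrite addr0.
rewrite (decomp_noim fD cD) ?inE ?vw ?orbT //= => /eqP[vy].
by rewrite -vy vw in yw.
Qed.

Lemma sum_cycle_end (G : T -> rat) c : (true, c) \in D ->
  \sum_(v <- c | sgn v && (f v == None)) G v = 0.
Proof.
move=> cD; rewrite big_seq_cond big1 // => v /and3P[vc _].
by rewrite (decomp_none fD cD).
Qed.

Lemma sum_cycle_start (G : T -> rat) c : (true, c) \in D ->
  \sum_(v <- c | ~~ sgn v && noim f v) G v = 0.
Proof.
move=> cD; rewrite big_seq_cond big1 // => v /and3P[vc _].
by rewrite (decomp_noim fD cD).
Qed.

Definition sum_links (c c' : bool * seq T) : rat :=
  \sum_(x <- c.2 | sgn x && (f x == None))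
     \sum_(y <- c'.2 | ~~ sgn y && noim f y) Fd x (Some y).

Lemma path_start_sgn y w : (false, y :: w) \in D ->
  last (sgn y) (map sgn w) = sgn y (+) odd (size w).
Proof.
move=> cD; have /andP[_ lc] := decomp_chain fD cD.
exact: linked_last_sgn lc.
Qed.

(** The only candidate is the arrow from the last element to the head. It requires an end in N^+ and
    a start in N^-, that is, sign + and an even number of elements. *)
Lemma sum_links_close c : c \in D ->
  sum_links c c = close_term F (chain_var c) (map chain_var (rem c D)).
Proof.
move=> cD; rewrite /sum_links; case: c cD => [[] c] cD /=.
  by rewrite sum_cycle_end.
have /andP[/= cn _] := decomp_chain fD cD.
case: c cn cD => // y w _ cD; have ls := path_start_sgn cD.
have dD := decomp_rem fD cD; move: (rem _ D) dD => r dD.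
have cD' : (false, rcons (belast y w) (last y w)) \in D by rewrite -lastI.
rewrite {1}lastI (sum_path_end _ cD') sum_path_start //.
rewrite /chain_var /= ls -(last_map sgn) ls.
case sy: (sgn y) => /=; first by case: odd.
case ow: (odd (size w)) => //=.
have ny : noim f y by rewrite (decomp_noim fD cD) ?mem_head //= eqxx.
have sx : sgn (last y w) by rewrite -(last_map sgn) ls sy ow.
rewrite (lastI y w) in dD.
by rewrite (FdE sx _ (decomp_close _ dD)) ?sy ?ny -?lastI //= /chain_var /=.
Qed.

(** The first path must end in N^+, so its sign is +. The second must start in N^-, which by
    alternation makes its sign [bar i] for length [i]; the joined path inherits its last element,
    hence its sign. *)
Lemma sum_links_join c c' : c \in D -> c' \in rem c D ->
  sum_links c c' = join_term F (chain_var c) (chain_var c')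
    (map chain_var (rem c' (rem c D))).
Proof.
move=> cD c'r; have c'D := mem_rem c'r; rewrite /sum_links.
have dD := decomp_rem fD cD.
have {}dD : decomp f (c :: c' :: rem c' (rem c D)).
  by apply: perm_decomp dD; rewrite perm_cons perm_to_rem.
move: (rem c' _) dD {c'r} => r dD.
case: c cD dD => [[] c] cD dD; first by rewrite sum_cycle_end.
have /andP[/= cn _] := decomp_chain fD cD.
case/lastP: c cn cD dD => // s x _ cD dD; rewrite sum_path_end //.
case: c' c'D dD => [[] c'] c'D dD.
  by rewrite sum_cycle_start // /chain_var /=; case: last; case: (sgn x).
have /andP[/= cn' _] := decomp_chain fD c'D.
case: c' cn' c'D dD => // y w _ c'D dD; rewrite sum_path_start //.
have ls := path_start_sgn c'D.
rewrite /chain_var /= map_rcons last_rcons ls size_rcons.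
case sx: (sgn x) => //=; rewrite /bar /=; case sy: (sgn y) => /=.
  by rewrite ifF //; case: odd.
have ny : noim f y by rewrite (decomp_noim fD c'D) ?mem_head //= eqxx.
rewrite negbK eqxx (FdE sx _ (decomp_join dD)) ?sy ?ny // /= /chain_var /=.
by rewrite map_cat last_cat /= ls sy size_cat size_rcons /= addnC.
Qed.

(** Elements are grouped by chains. A removed arrow concerns one chain; an added one concerns a pair
    of chains, and closes a path if they are equal and joins two if they are distinct. *)
Lemma move_sum :
  \sum_(x | sgn x && (f x != None)) Fd x None +
  \sum_(x | sgn x && (f x == None)) \sum_(y | ~~ sgn y && noim f y)
     Fd x (Some y) = Wsum (map chain_var D) F.
Proof.
rewrite Wsum_local big_map big_mkcond (sum_decomp _ fD).
rewrite [X in _ + X]big_mkcond (sum_decomp _ fD) -big_split /=.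
rewrite big_seq_cond [RHS]big_seq_cond; apply: eq_bigr => c /andP[cD _].
(* [rem] deletes the first occurrence of the variable, which may come from another chain, so the
   lists agree only up to permutation. *)
have pr : perm_eq (rem (chain_var c) (map chain_var D)) (map chain_var (rem c D)).
  by apply: perm_rem_cons; rewrite -map_cons perm_map // perm_to_rem.
have eq_F a s s' : perm_eq s s' -> F (a ++ s) = F (a ++ s').
  by move=> p; apply: F_perm; rewrite perm_cat2l.
have eq_cut v s s' : perm_eq s s' -> cut_term F v s = cut_term F v s'.
  move=> p; case: v => [[b|] k] /=; last by rewrite (eq_F [:: _] _ _ p).
  by apply: eq_bigr => j _; rewrite (eq_F [:: _; _] _ _ p).
have eq_close v s s' : perm_eq s s' -> close_term F v s = close_term F v s'.
  by move=> p; case: v => [[[]|] k] //=; rewrite (eq_F [:: _] _ _ p).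
have eq_join v w s s' : perm_eq s s' -> join_term F v w s = join_term F v w s'.
  by move=> p; case: v => [[[]|] k]; case: w => [[b|] l] //=; rewrite (eq_F [:: _] _ _ p).
rewrite -big_mkcond sum_cut_chain // (eq_cut _ _ _ pr) (eq_close _ _ _ pr) -addrA; congr (_ + _).
rewrite -big_mkcond /=.
transitivity (\sum_(c' <- D) sum_links c c').
  rewrite /sum_links [RHS]exchange_big /=; apply: eq_bigr => x _.
  by rewrite big_mkcond (sum_decomp _ fD); apply: eq_bigr => c' _; rewrite -big_mkcond.
rewrite (perm_big _ (perm_to_rem cD)) big_cons sum_links_close //; congr (_ + _).
rewrite (perm_big _ pr) big_map big_seq_cond [RHS]big_seq_cond.
apply: eq_bigr => c' /andP[c'r _]; rewrite sum_links_join //.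
apply: eq_join; rewrite perm_sym; apply: perm_rem_cons; rewrite (permPl pr).
by rewrite -map_cons perm_map // perm_to_rem.
Qed.

End Moves.

(** * Transitions *)

Section Transitions.
Variables np nm : nat.
Implicit Types (s : state np nm) (u v : vtx np nm).

Definition sgn v : bool := if v is inl _ then true else false.

Lemma state_inj s a a' b : val s a = Some b -> val s a' = Some b -> a = a'.
Proof.
move=> sa sa'; have /forallP/(_ a)/forallP/(_ a') := valP s.
by rewrite sa sa' eqxx => /eqP.
Qed.

Lemma partner_inr s a b : (partner s (inr b) == Some (inl a)) = (val s a == Some b).
Proof.
rewrite /=; case: pickP => [a' /eqP sa'|none] /=; last by rewrite none.
apply/eqP/eqP => [[<-]//|sa]; by rewrite (state_inj sa sa').
Qed.

Lemma partner_inl s a b : (partner s (inl a) == Some (inr b)) = (val s a == Some b).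
Proof. by rewrite /=; case: (val s a). Qed.

Lemma partner_sgn s u v : partner s u = Some v -> sgn v = ~~ sgn u.
Proof.
by case: u => [a|b] /=; [case: (val s a)|case: pickP] => //= ? => [|_] [<-].
Qed.

Lemma partner_sym s u v : (partner s u == Some v) = (partner s v == Some u).
Proof.
case: u v => [a|b] [a'|b'].
- by apply/eqP/eqP => /partner_sgn.
- by rewrite partner_inl partner_inr.
- by rewrite partner_inl partner_inr.
- by apply/eqP/eqP => /partner_sgn.
Qed.

(* Orienting the pairs of s from N^+ to N^- and those of s' from N^- to N^+
   turns the graph of a transition into a partial injection. *)
Definition succ s s' v : option (vtx np nm) :=
  if sgn v then partner s v else partner s' v.

Lemma succ_alternating s s' : alternating sgn (succ s s').
Proof. by move=> u v; rewrite /succ; case E: (sgn u) => /partner_sgn ->; rewrite E. Qed.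

Lemma succ_sym s s' u v :
  (succ s s' u == Some v) = ((if sgn v then partner s' v else partner s v) == Some u).
Proof.
rewrite /succ; case Eu: (sgn u); case Ev: (sgn v); try exact: partner_sym.
  by apply/eqP/eqP => /partner_sgn; rewrite Eu Ev.
by apply/eqP/eqP => /partner_sgn; rewrite Eu Ev.
Qed.

Lemma succ_inj s s' u v w : succ s s' u = Some w -> succ s s' v = Some w -> u = v.
Proof.
by move=> /eqP; rewrite succ_sym => /eqP E /eqP; rewrite succ_sym E => /eqP[].
Qed.

Lemma adjE s s' u v :
  adj s s' u v = (succ s s' u == Some v) || (succ s s' v == Some u).
Proof.
by rewrite (succ_sym _ _ v) /adj /succ; case: (sgn u) => //; rewrite orbC.
Qed.

Lemma noim_succ s s' u :
  noim (succ s s') u = ((if sgn u then partner s' u else partner s u) == None).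
Proof.
apply/forallP/eqP => [h|E v]; last by rewrite succ_sym E.
case E: (if _ then _ else _) => [v|] //.
by have := h v; rewrite succ_sym E eqxx.
Qed.

Lemma endpointE s s' u :
  (partner s u == None) || (partner s' u == None)
  = (succ s s' u == None) || noim (succ s s') u.
Proof. by rewrite noim_succ /succ; case: (sgn u) => //; rewrite orbC. Qed.

Lemma adj_sym s s' : connect_sym (adj s s').
Proof. by apply: sym_connect_sym => u v; rewrite !adjE orbC. Qed.

(** * Chains as connected components *)

Section Decomposition.
Variables (s s' : state np nm) (D : seq (bool * seq (vtx np nm))).
Hypothesis dD : decomp (succ s s') D.

Lemma linked_connect c o : linked (succ s s') c o -> {in c &, forall u v, connect (adj s s') u v}.
Proof.
have head_conn x w p : linked (succ s s') (x :: w) p ->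
    {in x :: w, forall u, connect (adj s s') x u}.
  elim: w x => [|y w IH] x /= /andP[/eqP fx lw] u.
    by rewrite inE => /eqP->; apply: connect0.
  rewrite inE => /orP[/eqP->|uw]; first exact: connect0.
  apply: connect_trans (IH _ lw _ uw); apply: connect1.
  by rewrite adjE fx eqxx.
case: c => // x w l u v uc vc.
apply: connect_trans (head_conn _ _ _ l _ vc).
by rewrite adj_sym; apply: (head_conn _ _ _ l).
Qed.

(** Links connect the elements of a chain. Conversely the chain is closed under [succ], and also
    under antecedents, since the chain of an antecedent meets it. *)
Lemma chain_component c v : c \in D -> v \in c.2 -> connect (adj s s') v =i c.2.
Proof.
move=> cD vc u; apply/idP/idP; last first.
  by have /andP[_ lc] := decomp_chain dD cD => uc; apply: linked_connect lc _ _ vc uc.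
move=> vu; suff cl : closed (adj s s') (mem c.2).
  by rewrite -[u \in c.2]/(u \in mem c.2) -(closed_connect cl vu).
have fw x y : succ s s' x = Some y -> x \in c.2 -> y \in c.2.
  move=> fx xc; have /andP[cn lc] := decomp_chain dD cD.
  have /(linked_imP _ lc cn)/orP[|] : exists2 x, x \in c.2 & succ s s' x = Some y by exists x.
    exact: mem_behead.
  by case: (c.1) => //; case: (c.2) => [|z w] //= /eqP[<-]; rewrite mem_head.
have bw x y : succ s s' x = Some y -> y \in c.2 -> x \in c.2.
  move=> fx yc; have [c' c'D xc'] := decomp_cover x dD.
  suff yc' : y \in c'.2 by rewrite (decomp_chain_eq dD cD c'D yc yc').
  have /andP[cn lc] := decomp_chain dD c'D.
  have /(linked_imP _ lc cn)/orP[|] : exists2 x, x \in c'.2 & succ s s' x = Some y by exists x.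
    exact: mem_behead.
  by case: (c'.1) => //; case: (c'.2) => [|z w] //= /eqP[<-]; rewrite mem_head.
move=> x y; rewrite adjE => /orP[] /eqP fx; apply/idP/idP; first [exact: fw fx|exact: bw fx].
Qed.

(** The endpoint picked by [desc] may be either end of the path; both possibilities are shown to
    give the sign of the last element. *)
Lemma desc_chain c v : c \in D -> v \in c.2 -> desc s s' v = chain_var sgn c.
Proof.
move=> cD vc; rewrite /desc.
have -> : [set u | connect (adj s s') v u] = [set u in c.2].
  by apply/setP => u; rewrite !inE -(chain_component cD vc).
rewrite cardsE (card_uniqP (decomp_chain_uniq dD cD)).
have E u : u \in c.2 -> (partner s u == None) || (partner s' u == None) =
    ~~ c.1 && ((Some u == ohead (rev c.2)) || (Some u == ohead c.2)).
  move=> uc; rewrite endpointE (decomp_none dD cD uc) (decomp_noim dD cD uc).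
  by case: c.1.
have /andP[cn lc] := decomp_chain dD cD.
case: c cD vc cn lc E => [[] c] /= cD vc cn lc E.
  by case: pickP => // u; rewrite inE => /andP[uc]; rewrite E.
case: pickP => [u|none]; last first.
  case: c cD vc cn lc E none => // x w cD vc _ lc E /(_ x).
  by rewrite inE mem_head E ?mem_head //= eqxx orbT.
rewrite inE => /andP[uc]; rewrite E // => {E} ends.
have [y [w Ec]] : exists y w, c = y :: w by case: (c) cn => // y w; exists y, w.
rewrite Ec in cD vc cn lc ends uc *; rewrite /chain_var /=.
have ls := linked_last_sgn (@succ_alternating s s') lc.
have lm : sgn (last y w) = sgn y (+) odd (size w) by rewrite -(last_map sgn).
have Ep : (partner s u == None) = if sgn u then u == last y w else u == y.
  move: (decomp_none dD cD uc) (decomp_noim dD cD uc).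
  rewrite noim_succ /succ /= [y :: w]lastI rev_rcons /= !(inj_eq Some_inj).
  by case: (sgn u) => // ->.
(* The ends of a path with an even number of elements have opposite signs, so they differ. *)
have ne : odd (size w) -> (y == last y w) = false.
  by move=> o; apply/eqP => E; move: lm; rewrite -E o; case: (sgn y).
rewrite ls Ep -/(sgn u).
move: ends; rewrite lastI rev_rcons -lastI /= => /orP[]/eqP[->].
  rewrite lm eqxx; case: (boolP (odd (size w))) => [o|_] //=.
  by rewrite eq_sym ne //; case: (sgn y).
rewrite eqxx; case: (boolP (odd (size w))) => [o|_] /=; last by rewrite addbF.
by rewrite ne //; case: (sgn y).
Qed.

(** Sending a chain to the root of its head is a bijection from the chains to the roots, and it
    preserves the variable. *)
Lemma typ_decomp : perm_eq (typ (s, s')) (map (chain_var sgn) D).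
Proof.
(* Option values are taken because N may be empty and offers no default vertex. *)
pose r (c : bool * seq (vtx np nm)) := omap (fingraph.root (adj s s')) (ohead c.2).
pose odesc o := oapp (desc s s') (qv 0) o.
have -> : typ (s, s') = map odesc (map Some (enum (roots (adj s s')))).
  by rewrite -map_comp.
have hd c : c \in D -> exists2 x, x \in c.2 & r c = Some (fingraph.root (adj s s') x).
  move=> cD; have /andP[cn _] := decomp_chain dD cD.
  by rewrite /r; case: c.2 cn => // x w _; exists x; rewrite ?mem_head.
have rc c x : c \in D -> x \in c.2 -> fingraph.root (adj s s') x \in c.2.
  by move=> cD xc; rewrite -(chain_component cD xc); apply: connect_root.
have -> : map (chain_var sgn) D = map odesc (map r D).
  rewrite -map_comp; apply/eq_in_map => c cD; have [x xc /= ->] := hd c cD.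
  by rewrite /= (desc_chain cD) // rc.
apply/perm_map/uniq_perm.
- by rewrite (map_inj_uniq Some_inj) enum_uniq.
- rewrite map_inj_in_uniq ?(decomp_uniq dD) // => c c' cD c'D.
  have [x xc ->] := hd c cD; have [x' xc' ->] := hd c' c'D => -[E].
  by apply: (decomp_chain_eq dD cD c'D (rc _ _ cD xc)); rewrite E rc.
- move=> o; apply/mapP/mapP => [[x]|[c cD ->]].
    rewrite mem_enum => /eqP xr ->; have [c cD xc] := decomp_cover x dD.
    exists c => //; have [y yc ->] := hd c cD; congr Some; rewrite -[LHS]xr.
    apply/eqP; rewrite root_connect; last exact: adj_sym.
    by rewrite -[connect _ _ _]/(_ \in connect _ _) (chain_component cD xc).
  have [x xc ->] := hd c cD; exists (fingraph.root (adj s s') x) => //.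
  by rewrite mem_enum; apply: roots_root; apply: adj_sym.
Qed.

End Decomposition.

(** The default [s] is returned if the modified function is not a matching, that is, if the new
    partner is already taken. *)
Definition state_upd s a o : state np nm :=
  insubd s [ffun a' => if a' == a then o else val s a'].

Lemma val_state_upd s a o :
  (if o is Some b then [forall a', val s a' != Some b] else true) ->
  val (state_upd s a o) = [ffun a' => if a' == a then o else val s a'].
Proof.
move=> h; apply: insubdK; apply/forallP => a1; apply/forallP => a2.
rewrite !ffunE; apply/implyP => n; apply/implyP => /eqP; move: n.
case: (a1 =P a) => [->|_]; case: (a2 =P a) => [->|_] // n E; apply/eqP => //.
- by case: o h n E => // b /forallP/(_ a2) + _ E; rewrite E eqxx.
- by case: o h E => [b /forallP/(_ a1) + E|_ E]; [rewrite E eqxx|rewrite E in n].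
- by case E1: (val s a1) n E => [b|] // _ /esym; apply: state_inj.
Qed.

(** Arrows issued from N^+ come from the initial state and those issued from N^- from the final one,
    so a new partner of [a] changes a single arrow. *)
Lemma succ_state_upd s s' a o :
  (if o is Some b then [forall a', val s a' != Some b] else true) ->
  succ (state_upd s a o) s' =1 upd (succ s s') (inl a) (omap inr o).
Proof.
move=> h [a'|b] //; rewrite /succ /upd /= val_state_upd // ffunE.
by rewrite -[inl a' == inl a]/(a' == a); case: eqP.
Qed.

Lemma transposition_sym s s' : transposition (s, s') = transposition (s', s).
Proof.
apply: eq_existsb => a; apply: eq_existsb => b /=; congr (_ && _).
  by rewrite orbC; congr (_ || _); apply: andbC.
by apply: eq_forallb => a'; congr (_ ==> _); apply: eq_sym.
Qed.

End Transitions.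

(** * Multiplication by the sum of transpositions *)

Section TranspositionSum.
Variables np nm : nat.
Implicit Types (s : state np nm).

Definition paired s := [set a | val s a != None].

Definition free_pairs s :=
  [set m : 'I_np * 'I_nm | (val s m.1 == None) && [forall a, val s a != Some m.2]].

Definition unpair s a := state_upd s a None.
Definition pair_up s (m : 'I_np * 'I_nm) := state_upd s m.1 (Some m.2).

Lemma val_unpair s a : val (unpair s a) = [ffun a' => if a' == a then None else val s a'].
Proof. exact: val_state_upd. Qed.

Lemma val_pair_up s m : m \in free_pairs s ->
  val (pair_up s m) = [ffun a' => if a' == m.1 then Some m.2 else val s a'].
Proof. by rewrite inE => /andP[_ h]; apply: val_state_upd. Qed.

Lemma unpair_inj s : {in paired s &, injective (unpair s)}.
Proof.
move=> a a'; rewrite !inE => sa sa' E; apply/eqP.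
have := congr1 (fun t : state np nm => val t a) E; rewrite !val_unpair !ffunE eqxx.
by case: eqP => // _ /esym/eqP; rewrite (negPf sa).
Qed.

Lemma pair_up_inj s : {in free_pairs s &, injective (pair_up s)}.
Proof.
move=> [a b] [a' b'] m m' E.
have := congr1 (fun t : state np nm => val t a) E; rewrite !val_pair_up // !ffunE eqxx /=.
case: eqP => [-> [->]//|_].
by move: m; rewrite inE => /andP[/eqP /= ->].
Qed.

Lemma unpair_pair_up_disjoint s :
  [disjoint unpair s @: paired s & pair_up s @: free_pairs s].
Proof.
apply/pred0P => t /=; apply/negP => /andP[/imsetP[a + ->] /imsetP[[a' b] m E]].
rewrite inE => sa; have := congr1 (fun t : state np nm => val t a) E.
rewrite val_unpair val_pair_up // !ffunE eqxx /=.
by case: eqP => // _ /esym/eqP; rewrite (negPf sa).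
Qed.

Lemma transpositions_from s :
  [set t | transposition (s, t)] = unpair s @: paired s :|: pair_up s @: free_pairs s.
Proof.
apply/setP => t; rewrite !inE; apply/existsP/orP => [[a /existsP[b]]|[]] /=.
- case/andP=> + /forallP h.
  have E a' : a' != a -> val s a' = val t a' by move=> n; apply/eqP; exact: (implyP (h a')).
  case/orP=> /andP[/eqP sa /eqP ta].
    left; apply/imsetP; exists a; first by rewrite inE sa.
    apply/val_inj; rewrite val_unpair; apply/ffunP => a'; rewrite ffunE.
    by case: (eqVneq a' a) => [->|/E].
  (* The element [b] is free in [s]: a partner other than [a] would still be its partner in [t],
     where [b] is paired with [a]. *)
  right; have m : (a, b) \in free_pairs s.
    rewrite inE sa eqxx; apply/forallP => a' /=.
    case: (eqVneq a' a) => [->|n]; first by rewrite sa.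
    rewrite E //; apply: contra n => /eqP ta'; apply/eqP; exact: state_inj ta' ta.
  apply/imsetP; exists (a, b) => //.
  apply/val_inj; rewrite val_pair_up //; apply/ffunP => a'; rewrite ffunE /=.
  by case: (eqVneq a' a) => [->|/E].
- case/imsetP=> a; rewrite inE; case sa: (val s a) => [b|] // _ ->.
  exists a; apply/existsP; exists b; apply/andP.
  rewrite val_unpair; split; first by rewrite ffunE sa !eqxx.
  by apply/forallP => a'; apply/implyP => /negPf n; rewrite ffunE n.
- case/imsetP=> [[a b] m ->]; exists a; apply/existsP; exists b; apply/andP.
  rewrite val_pair_up //; split.
    by move: m; rewrite inE ffunE !eqxx => /andP[/= -> _]; rewrite orbT.
  by apply/forallP => a'; apply/implyP => /negPf n; rewrite ffunE n.
Qed.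

(** This is [move_sum] for the partial injection [succ s s']: breaking or forming a pair of [s]
    removes or adds one arrow issued from N^+. *)
Lemma sum_transpositions F s s' : perm_invariant F ->
  \sum_(t | transposition (s, t)) F (typ (t, s')) = Wsum (typ (s, s')) F.
Proof.
move=> Fp; have [D dD] := decomp_exists (@succ_inj np nm s s').
rewrite (eq_Wsum Fp (typ_decomp dD)).
(* The last case covers only changes that are not moves; its value 0 is arbitrary. *)
pose Fd (x : vtx np nm) (o : option (vtx np nm)) : rat := match x, o with
  | inl a, None => F (typ (unpair s a, s'))
  | inl a, Some (inr b) => F (typ (pair_up s (a, b), s'))
  | _, _ => 0 end.
have free_noim b : noim (succ s s') (inr b) = [forall a, val s a != Some b].
  apply/forallP/forallP => [h a|h [a|b']].
  - by have := h (inl a); rewrite /succ /=; case: (val s a).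
  - by have := h a; rewrite /succ /=; case: (val s a).
  - by rewrite /succ /=; case: pickP.
rewrite -(move_sum (Fd := Fd) Fp (@succ_alternating _ _ s s') dD); last first.
  move=> [a|//] [[//|b]|] D' _ /=; rewrite ?free_noim => h dD'; apply: Fp; apply: typ_decomp.
    by apply: eq_decomp dD' => v; rewrite succ_state_upd.
  by apply: eq_decomp dD' => v; rewrite succ_state_upd.
rewrite [LHS](eq_bigl (mem [predU unpair s @: paired s & pair_up s @: free_pairs s])); last first.
  by move=> t; have /setP/(_ t) := transpositions_from s; rewrite !inE.
rewrite bigU ?unpair_pair_up_disjoint //=.
rewrite !big_imset /=; [|exact: pair_up_inj|exact: unpair_inj].
rewrite !big_sumType /= !big_pred0_eq !addr0; congr (_ + _).
  by apply: eq_bigl => a; rewrite inE /succ /=; case: (val s a).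
transitivity (\sum_(a | val s a == None) \sum_(b | [forall a', val s a' != Some b])
   F (typ (pair_up s (a, b), s'))).
  by rewrite pair_big_dep; apply: eq_big => -[a b]; rewrite ?inE.
apply: eq_big => [a|a _]; first by rewrite /succ /=; case: (val s a).
by rewrite big_sumType /= big_pred0_eq add0r; apply: eq_bigl => b; rewrite free_noim.
Qed.

End TranspositionSum.

(** * Double counting of pairs of transitions *)

Lemma card_type_sum np nm mu nu :
  (Defs.cardC np nm nu)%:R * Wsum nu (same_monomial mu) =
  \sum_(s : state np nm) \sum_s' \sum_t
     (transposition (s, t))%:R * same_monomial nu (typ (s, s')) * same_monomial mu (typ (t, s')).
Proof.
rewrite pair_bigA /=.
transitivity (\sum_(p : trans np nm) same_monomial nu (typ p) * Wsum nu (same_monomial mu)).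
  rewrite -mulr_suml; congr (_ * _); rewrite /Defs.cardC /same_monomial -sum1_card natr_sum big_mkcond.
  by apply: eq_bigr => p _; rewrite unfold_in /=; case: perm_eq.
apply: eq_bigr => -[s s'] _ /=; rewrite /same_monomial; case: (boolP (perm_eq (typ _) nu)) => p.
  rewrite mul1r -(eq_Wsum (@same_monomial_perm mu) p) -sum_transpositions; last exact: same_monomial_perm.
  by rewrite big_mkcond; apply: eq_bigr => t _; rewrite mulr1; case: ifP; rewrite ?mul1r ?mul0r.
by rewrite mul0r big1 // => t _; rewrite mulr0 mul0r.
Qed.

(** Both sides count the triples of states [s], [t], [s'] with [(s, t)] a transposition and
    [(s, s')], [(t, s')] of the two given types; the sides correspond by exchanging [s] and [t]. *)
Lemma card_type_Wsum np nm mu nu :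
  (Defs.cardC np nm nu)%:R * Wsum nu (same_monomial mu) =
  (Defs.cardC np nm mu)%:R * Wsum mu (same_monomial nu).
Proof.
rewrite !card_type_sum exchange_big [RHS]exchange_big /=; apply: eq_bigr => s' _.
rewrite exchange_big; apply: eq_bigr => s _; apply: eq_bigr => t _.
by rewrite transposition_sym mulrAC.
Qed.

Theorem theorem4p1 (np nm : nat) (mu : seq var) :
  all (fun x : var => 0 < x.2)%N mu ->
  nplus mu = np -> nminus mu = nm ->
  mulT (C2 np nm) (Phi np nm [:: (1, mu)]) = Phi np nm (Wplus mu).
Proof.
move=> _ _ _; apply/ffunP => -[s s']; rewrite !ffunE /=; set nu := typ (s, s').
have -> : \sum_t C2 np nm (s, t) * Phi np nm [:: (1, mu)] (t, s') =
    Wsum nu (same_monomial mu) / (Defs.cardC np nm mu)%:R.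
  rewrite -sum_transpositions; last exact: same_monomial_perm.
  rewrite mulr_suml [RHS]big_mkcond; apply: eq_bigr => t _.
  rewrite !ffunE big_seq1 ffunE mul1r /same_monomial.
  by case: (transposition _); rewrite ?mul1r ?mul0r.
(* Only the terms of W^+ p_mu with monomial p_nu are nonzero at a transition of type [nu], and all
   of them have the denominator |C_nu|. *)
have -> : \sum_(x <- Wplus mu) x.1 * (Cmu np nm x.2 (s, s') / (Defs.cardC np nm x.2)%:R) =
    Wsum mu (same_monomial nu) / (Defs.cardC np nm nu)%:R.
  rewrite /Wsum mulr_suml; apply: eq_bigr => x _.
  rewrite ffunE -mulrA /same_monomial [perm_eq x.2 _]perm_sym.
  case: (boolP (perm_eq nu x.2)) => [p|_]; last by rewrite /= !mul0r.
  congr (_ * (_ / _%:R)); apply: eq_card => y; rewrite !unfold_in /=.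
  by rewrite (permPr p).
have nu0 : (Defs.cardC np nm nu)%:R != 0 :> rat.
  rewrite pnatr_eq0 -lt0n; apply/card_gt0P; exists (s, s').
  by rewrite unfold_in /=.
have [mu0|mu0] := eqVneq ((Defs.cardC np nm mu)%:R : rat) 0; last first.
  by apply/eqP; rewrite eqr_div // mulrC card_type_Wsum mulrC.
(* If C_mu is empty, division by 0 makes the left side 0. The counting identity then annihilates the
   coefficient of p_mu in W^+ p_nu, because |C_nu| is nonzero, and reversal of terms annihilates the
   one on the right. *)
rewrite mu0 invr0 mulr0.
have := card_type_Wsum np nm mu nu; rewrite mu0 mul0r => /eqP.
rewrite mulf_eq0 (negPf nu0) /= => /eqP W0.
have [->|/Wsum_neq0_sym] := eqVneq (Wsum mu (same_monomial nu)) 0; first by rewrite mul0r.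
by rewrite W0 eqxx.
Qed.
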